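(* Let $k\geq\ell\geq1$ be integers. If $G$ is a connected claw-free $(k+\ell+1)$-regular graph of order $n$, then $$\gamma_{P,k}(G)\le \frac{n}{k+\ell+2}.$$ Moreover, this bound is tight: for all integers $k\geq\ell\geq1$ there exists a connected claw-free $(k+\ell+1)$-regular graph $G$ of order $n$ with $\gamma_{P,k}(G)=n/(k+\ell+2)$.
   Context: All graphs are finite, simple and undirected. The order of a graph $G$ is $|V(G)|$. A graph is claw-free if it has no induced subgraph isomorphic to $K_{1,3}$. For $v\in V(G)$, $N_G(v)$ is the set of neighbors of $v$, $N_G[v]=N_G(v)\cup\{v\}$, and for $S\subseteq V(G)$, $N_G[S]=\bigcup_{v\in S}N_G[v]$. For an integer $k\ge0$ and $S\subseteq V(G)$, define recursively $P_G^{0}(S)=N_G[S]$ and, for $i\ge0$, $$P_G^{i+1}(S)=\bigcup\{N_G[v]: v\in P_G^{i}(S),\ |N_G[v]\setminus P_G^{i}(S)|\leq k\}.$$ If $P_G^{i_0}(S)=P_G^{i_0+1}(S)$ for some $i_0$, then $P_G^{j}(S)=P_G^{i_0}(S)$ for all $j\ge i_0$, and one sets $P_G^{\infty}(S)=P_G^{i_0}(S)$. The set $S$ is a $k$-power dominating set ($k$-PD-set) of $G$ if $P_G^{\infty}(S)=V(G)$. The $k$-power domination number $\gamma_{P,k}(G)$ is the minimum cardinality of a $k$-PD-set of $G$. *)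

(* Defs.v *)
From mathcomp Require Import all_boot.

Set Implicit Arguments.
Unset Strict Implicit.
Unset Printing Implicit Defensive.

Record sgraph := SGraph {
  vertex :> finType;
  adj : rel vertex;
  adj_sym : symmetric adj;
  adj_irr : irreflexive adj }.

Definition isomorphic (G H : sgraph) : Prop :=
  exists2 f : G -> H, bijective f & forall x y, adj (f x) (f y) = adj x y.

Section InducedSubgraph.
Variables (G : sgraph) (S : {set G}).

Definition induced_adj : rel {x : G | x \in S} :=
  fun x y => adj (val x) (val y).

Lemma induced_adj_sym : symmetric induced_adj.
Proof. by move=> x y; apply: adj_sym. Qed.

Lemma induced_adj_irr : irreflexive induced_adj.
Proof. by move=> x; apply: adj_irr. Qed.

Definition induced : sgraph := SGraph induced_adj_sym induced_adj_irr.

End InducedSubgraph.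

Section CompleteBipartite.
Variables m n : nat.

Definition biclique_adj : rel ('I_m + 'I_n) :=
  fun x y => is_inl x != is_inl y.

Lemma biclique_adj_sym : symmetric biclique_adj.
Proof. by move=> x y; rewrite /biclique_adj eq_sym. Qed.

Lemma biclique_adj_irr : irreflexive biclique_adj.
Proof. by move=> x; rewrite /biclique_adj eqxx. Qed.

Definition biclique : sgraph := SGraph biclique_adj_sym biclique_adj_irr.

End CompleteBipartite.

Definition claw_free (G : sgraph) : Prop :=
  ~ exists S : {set G}, isomorphic (induced S) (biclique 1 3).

(* A connected graph is nonempty by convention. *)
Definition connected (G : sgraph) : Prop :=
  0 < #|G| /\ forall x y : G, connect (@adj G) x y.

Section PowerDomination.
Variables (G : sgraph) (k : nat).
Implicit Types (v : G) (S : {set G}).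

Definition nbhd v : {set G} := [set u | adj v u].
Definition cl_nbhd v : {set G} := v |: nbhd v.
Definition cl_nbhds S : {set G} := \bigcup_(v in S) cl_nbhd v.

Fixpoint pd_iter S (i : nat) : {set G} :=
  if i is j.+1 then
    \bigcup_(v in pd_iter S j | #|cl_nbhd v :\: pd_iter S j| <= k) cl_nbhd v
  else cl_nbhds S.

Lemma pd_iter_covered S i u : u \in pd_iter S i ->
  exists v, u \in cl_nbhd v /\ cl_nbhd v \subset pd_iter S i.
Proof.
case: i => [|i] /= /bigcupP[v Pv uv]; exists v; split=> //.
  exact: (bigcup_sup v).
exact: (bigcup_sup v).
Qed.

Lemma pd_iter_sub S i : pd_iter S i \subset pd_iter S i.+1.
Proof.
apply/subsetP=> u /pd_iter_covered[v [uv vS]].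
apply/bigcupP; exists v => //.
rewrite (subsetP vS) ?setU11 //=.
by move: vS; rewrite -setD_eq0 => /eqP->; rewrite cards0.
Qed.

Lemma pd_iter_stable S : exists i, pd_iter S i == pd_iter S i.+1.
Proof.
have [/existsP[i ?]|/existsPn neq] :=
  boolP [exists i : 'I_#|G|.+1, pd_iter S i == pd_iter S i.+1].
  by exists i.
have card_ge i : i <= #|G|.+1 -> i <= #|pd_iter S i|.
  elim: i => // i IHi lt_i; apply: leq_ltn_trans (IHi (ltnW lt_i)) _.
  by apply: proper_card; rewrite properEneq (neq (Ordinal lt_i)) pd_iter_sub.
by have := leq_trans (card_ge _ (leqnn _)) (max_card _); rewrite ltnn.
Qed.

Definition pd_infty S : {set G} := pd_iter S (ex_minn (pd_iter_stable S)).

Lemma pd_inftyE S i :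
  pd_iter S i = pd_iter S i.+1 -> pd_infty S = pd_iter S i.
Proof.
rewrite /pd_infty; case: ex_minnP => i0 /eqP st min_i0 /eqP/min_i0 le_i0.
have stj j : pd_iter S (i0 + j) = pd_iter S i0.
  by elim: j => [|j IHj]; rewrite ?addn0 // addnS /= IHj [RHS]st.
by rewrite -(subnKC le_i0) stj.
Qed.

Definition pd_set S : bool := pd_infty S == [set: G].

Lemma pd_setT : pd_set [set: G].
Proof.
have T0 : pd_iter setT 0 = setT.
  by apply/setP=> v; rewrite inE; apply/bigcupP; exists v; rewrite ?inE ?eqxx.
have st : pd_iter setT 0 = pd_iter setT 1.
  by apply/eqP; rewrite eqEsubset pd_iter_sub T0 subsetT.
by rewrite /pd_set (pd_inftyE st) T0.
Qed.

(* The minimum is taken over a nonempty family by [pd_setT]. *)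
Definition pd_number : nat :=
  #|[arg min_(S < [set: G] | pd_set S) #|S|]|.

End PowerDomination.

Definition regular (G : sgraph) (r : nat) : Prop :=
  forall v : G, #|nbhd v| = r.

(* Main.v *)
Require Import Defs.
From mathcomp Require Import all_boot all_order all_algebra.
From mathcomp Require Import zify.

(** The upper bound holds because, when all degrees are at most 2k+1, a
    connected claw-free graph has a k-power dominating set [S] whose closed
    neighbourhoods are pairwise disjoint ([packing_pd_set]); in a graph with all
    degrees k+l+1 such an [S] satisfies |S| (k+l+2) <= n.

    Say that [P] is propagation-closed when no further step enlarges it; the set
    finally observed from [S] is the least propagation-closed set containing
    N[S].  Let [P] be such a set, and [v] in [P] a vertex with a neighbour
    outside [P].  It has at least k+1 of them, and one neighbour [w] with N[w]
    inside [P], as every vertex is first observed together with a whole closed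
    neighbourhood.  Two non-adjacent neighbours of [v] outside [P] would form a
    claw with [w], so [v] and its unobserved neighbours form a clique with at
    least k+2 vertices, called big here ([frontier_big_clique]).

    The degree bound 2k+1 gives big cliques two properties.  An observed big
    clique observes its whole neighbourhood, each of its vertices having at most
    k neighbours outside it ([big_clique_activates]).  Two big cliques sharing a
    vertex share a second one ([big_cliques_meet_twice]).

    If there is no big clique, propagation never stops early, and one vertex
    suffices.  Otherwise the vertices in big cliques form a power dominating
    set; let [S] be a minimal one among its subsets.  Let P_s be the set observed
    from S - s.  By minimality a big clique containing [s] is not inside P_s;
    replace [s] by a vertex u_s of that clique outside P_s.  The set of all u_s
    still observes everything, since u_s activates the clique.  Suppose that [x]
    belongs to both N[u_s] and N[u_t], with s <> t.  Since [t] alone already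
    causes N[u_t] to be observed, [x] and all of N[u_t] lie in P_s, and
    symmetrically [x] and N[u_s] lie in P_t.  So [x] spans a big clique with its
    neighbours outside P_s, and another with its neighbours outside P_t.  They
    share a vertex besides [x], lying outside P_s and equal or adjacent to u_t,
    which contradicts that N[u_t] lies in P_s.

    Complete graphs attain the bound. *)

(** * Claws *)

Section Claw.
Variable G : sgraph.
Implicit Types v a b c : G.

(** Otherwise [v], [a], [b], [c] induce a claw; mapping the claw into the graph
    and inverting that map onto its image gives the isomorphism required. *)
Lemma claw_free_nbrs v a b c : claw_free G ->
  adj v a -> adj v b -> adj v c -> a != b -> a != c -> b != c ->
  [|| adj a b, adj a c | adj b c].
Proof.
move=> cfG va vb vc nab nac nbc; apply/negPn/negP; rewrite !negb_or.
case/and3P=> /negbTE Nab /negbTE Nac /negbTE Nbc; apply: cfG.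
pose g (x : biclique 1 3) : G :=
  match x with inl _ => v | inr i => nth a [:: a; b; c] i end.
have gadj x y : adj (g x) (g y) = adj x y.
  case: x => [x|[[|[|[|x]]] hx]]; case: y => [y|[[|[|[|y]]] hy]] //=;
    by rewrite ?adj_irr ?va ?vb ?vc ?Nab ?Nac ?Nbc // adj_sym ?va ?vb ?vc ?Nab ?Nac ?Nbc.
have ginj : injective g.
  have neq_adj (x y : G) : adj x y -> (x == y = false) * (y == x = false).
    move=> xy; suff xNy : x == y = false by split=> //; rewrite eq_sym.
    by apply: contraTF xy => /eqP->; rewrite adj_irr.
  have neqs := (neq_adj _ _ va, neq_adj _ _ vb, neq_adj _ _ vc,
    negbTE nab, negbTE nac, negbTE nbc, eq_sym b a, eq_sym c a, eq_sym c b).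
  case=> [x|[[|[|[|x]]] hx]]; case=> [y|[[|[|[|y]]] hy]] //= /eqP; rewrite ?neqs // => _.
  - by congr inl; rewrite [x]ord1 [y]ord1.
  - by congr inr; apply: val_inj.
  - by congr inr; apply: val_inj.
  - by congr inr; apply: val_inj.
pose S := [set g x | x : biclique 1 3].
have gS x : g x \in S by apply: imset_f.
pose h (x : biclique 1 3) : induced S := exist _ (g x) (gS x).
have hsurj (y : induced S) : exists x, h x == y.
  by case: y => y yS; case/imsetP: (yS) => x _ yx; exists x; rewrite -val_eqE /= yx.
pose f y := xchoose (hsurj y).
have fK : cancel f h by move=> y; apply/eqP/(xchooseP (hsurj y)).
have hK : cancel h f.
  by move=> x; apply: ginj; have /(congr1 val) := fK (h x).
exists S; exists f; first by exists h.
by move=> x y; rewrite -gadj -[x in RHS]fK -[y in RHS]fK.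
Qed.

End Claw.

(** * Closed neighbourhoods and propagation *)

Section Propagation.
Variables (G : sgraph) (k : nat).
Implicit Types (v u x : G) (S P K : {set G}).

Lemma in_cl_nbhd v u : (u \in cl_nbhd v) = (u == v) || adj v u.
Proof. by rewrite !inE. Qed.

Lemma cl_nbhd_refl v : v \in cl_nbhd v.
Proof. by rewrite in_cl_nbhd eqxx. Qed.

Lemma card_cl_nbhd v : #|cl_nbhd v| = #|nbhd v|.+1.
Proof. by rewrite cardsU1 inE adj_irr. Qed.

Definition prop_closed P :=
  forall v, v \in P -> #|cl_nbhd v :\: P| <= k -> cl_nbhd v \subset P.

Lemma pd_infty_iter S :
  exists2 i, pd_infty k S = pd_iter k S i & pd_iter k S i = pd_iter k S i.+1.
Proof.
case: (pd_iter_stable k S) => i /eqP st.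
by exists i => //; apply: pd_inftyE.
Qed.

Lemma pd_infty_closed S : prop_closed (pd_infty k S).
Proof.
case: (pd_infty_iter S) => i -> st v vP le_k.
by rewrite st /=; apply: (bigcup_sup v); rewrite ?vP.
Qed.

Lemma cl_nbhd_sub_infty S v : v \in S -> cl_nbhd v \subset pd_infty k S.
Proof.
move=> vS; case: (pd_infty_iter S) => i -> _.
apply: (@subset_trans _ _ (pd_iter k S 0)); first exact: (bigcup_sup v).
elim: i => [|i IHi]; first exact: subxx.
exact: subset_trans IHi (pd_iter_sub k S i).
Qed.

Lemma pd_infty_covered S u : u \in pd_infty k S ->
  exists v, u \in cl_nbhd v /\ cl_nbhd v \subset pd_infty k S.
Proof. by case: (pd_infty_iter S) => i -> _; apply: pd_iter_covered. Qed.

Lemma pd_infty_min S P : prop_closed P ->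
  (forall v, v \in S -> cl_nbhd v \subset P) -> pd_infty k S \subset P.
Proof.
move=> clP SP; case: (pd_infty_iter S) => i -> _.
elim: i => [|i IHi] /=; first by apply/bigcupsP.
apply/bigcupsP=> v /andP[vi le_k]; apply: clP; first exact: (subsetP IHi).
by apply: leq_trans le_k; apply: subset_leq_card; apply: setDS.
Qed.

Lemma pd_number_le S : pd_set k S -> pd_number G k <= #|S|.
Proof.
by rewrite /pd_number; case: arg_minnP => [|T _ min_T /min_T //]; apply: pd_setT.
Qed.

Lemma pd_set_nonempty S : 0 < #|G| -> pd_set k S -> 0 < #|S|.
Proof.
move=> /card_gt0P[x _] /eqP ST; rewrite card_gt0; apply/eqP=> S0.
suff /subsetP/(_ x) : pd_infty k S \subset set0 by rewrite ST !inE => /(_ isT).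
by apply: pd_infty_min => v; rewrite ?S0 !inE.
Qed.

(** By connectedness, propagation can only end early at an observed vertex that
    still has an unobserved neighbour. *)
Lemma pd_set_of_no_frontier S v : connected G -> v \in S ->
  (forall x y, x \in pd_infty k S -> adj x y -> y \in pd_infty k S) ->
  pd_set k S.
Proof.
case=> _ conn vS clos; rewrite /pd_set -subTset; apply/subsetP=> y _.
have vP : v \in pd_infty k S := subsetP (cl_nbhd_sub_infty _ _ vS) _ (cl_nbhd_refl v).
case/connectP: (conn v y) => p pth ->.
elim: p v vP {vS} pth => //= z p IHp v vP /andP[vz]; apply: IHp.
exact: clos vP vz.
Qed.

(** * Big cliques *)

Definition clique K := [forall x in K, K \subset cl_nbhd x].

Definition big_clique K := clique K && (k.+1 < #|K|).

Definition in_big_clique x := [exists K : {set G}, (x \in K) && big_clique K].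

(** A vertex where propagation is stuck has more than k unobserved neighbours,
    pairwise adjacent because of the claw they would form with the fully observed
    neighbour from which that vertex was observed. *)
Lemma frontier_big_clique S x y : claw_free G ->
  x \in pd_infty k S -> adj x y -> y \notin pd_infty k S ->
  big_clique (x |: (nbhd x :\: pd_infty k S)).
Proof.
move=> cfG xP xy yNP; set P := pd_infty k S.
have [w [xw wP]] := pd_infty_covered _ _ xP.
have xNw : ~~ (cl_nbhd x \subset P).
  by apply: contra yNP => /subsetP; apply; rewrite in_cl_nbhd xy orbT.
have ADE : cl_nbhd x :\: P = nbhd x :\: P.
  apply/setP=> z; rewrite !inE; case: (z =P x) => // ->.
  by rewrite -/P [x \in P]xP.
have adj_xw : adj x w.
  move: xw; rewrite in_cl_nbhd => /orP[/eqP ew|]; last by rewrite adj_sym.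
  by rewrite ew wP in xNw.
(* [w] is adjacent to no unobserved vertex, so it completes a claw at [x]. *)
have Nw z : z \notin P -> ~~ (z \in cl_nbhd w).
  by apply: contra; apply: (subsetP wP).
apply/andP; split; last first.
  rewrite cardsU1 !inE xP /= add1n ltnS -ADE ltnNge.
  apply: contra xNw => le_k; exact: (pd_infty_closed _ _ xP le_k).
apply/forall_inP=> a; rewrite !inE => aK; apply/subsetP=> b; rewrite !inE => bK.
case: (b =P a) => //= /eqP nba.
case/orP: aK => [/eqP ea|/andP[aP xa]].
  by case/orP: bK => [/eqP eb|/andP[_ xb]]; [rewrite ea eb eqxx in nba|rewrite ea].
case/orP: bK => [/eqP eb|/andP[bP xb]]; first by rewrite eb adj_sym.
have := Nw _ aP; rewrite in_cl_nbhd negb_or => /andP[naw Nwa].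
have := Nw _ bP; rewrite in_cl_nbhd negb_or => /andP[nbw Nwb].
have := claw_free_nbrs _ _ _ _ _ cfG xa xb adj_xw.
rewrite eq_sym nba naw nbw [adj a w]adj_sym [adj b w]adj_sym.
by rewrite (negbTE Nwa) (negbTE Nwb) !orbF; apply.
Qed.

Hypothesis degG : forall v, #|nbhd v| <= (2 * k).+1.

(** A vertex of the clique has at most 2k+2 vertices in its closed neighbourhood,
    of which at least k+2 are in the clique, so at most k are unobserved. *)
Lemma big_clique_activates P K x : prop_closed P -> big_clique K ->
  K \subset P -> x \in K -> cl_nbhd x \subset P.
Proof.
move=> clP /andP[/forall_inP cK gtK] KP xK; apply: clP; first exact: (subsetP KP).
apply: (@leq_trans #|cl_nbhd x :\: K|).
  by apply: subset_leq_card; apply: setDS.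
have := degG x.
by rewrite cardsDS ?cK // card_cl_nbhd; lia.
Qed.

Lemma big_clique_activated P K u x : prop_closed P -> big_clique K ->
  u \in K -> cl_nbhd u \subset P -> x \in K -> cl_nbhd x \subset P.
Proof.
move=> clP bK uK uP; apply: big_clique_activates => //.
case/andP: bK => /forall_inP cK _; exact: subset_trans (cK _ uK) uP.
Qed.

(** The union of the two cliques lies in N[x], of size at most 2k+2, whereas
    their sizes add up to at least 2k+4. *)
Lemma big_cliques_meet_twice x K L : big_clique K -> big_clique L ->
  x \in K -> x \in L -> exists2 y, y != x & y \in K :&: L.
Proof.
move=> /andP[/forall_inP cK gtK] /andP[/forall_inP cL gtL] xK xL.
have gt1 : 1 < #|K :&: L|.
  have : #|K :|: L| <= #|cl_nbhd x|.
    by apply: subset_leq_card; rewrite subUset cK ?cL.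
  have := cardsUI K L; have := degG x; rewrite card_cl_nbhd; lia.
have : 0 < #|(K :&: L) :\ x| by rewrite (cardsD1 x) in_setI xK xL in gt1.
by case/card_gt0P=> y /setD1P[yx yKL]; exists y.
Qed.

(** * Power dominating packings *)

Definition packing S :=
  {in S &, forall u v, u != v -> [disjoint cl_nbhd u & cl_nbhd v]}.

(** A common vertex [x] of N[u] and N[v] would be stuck in both propagations:
    from [S] because of [u], from [T] because of [v].  The two big cliques this
    gives at [x] share a vertex unobserved from [S], yet the one containing [v]
    lies in N[v], which is observed from [S]. *)
Lemma frontiers_disjoint S T x u v : claw_free G ->
  u \notin pd_infty k S -> cl_nbhd v \subset pd_infty k S ->
  v \notin pd_infty k T -> cl_nbhd u \subset pd_infty k T ->
  x \in cl_nbhd u -> x \in cl_nbhd v -> False.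
Proof.
move=> cfG uS vS vT uT xu xv.
have xS := subsetP vS _ xv; have xT := subsetP uT _ xu.
have adjx P z : z \notin P -> x \in P -> x \in cl_nbhd z -> adj x z.
  by move=> zP xP; rewrite in_cl_nbhd adj_sym => /orP[/eqP ex|//]; rewrite -ex xP in zP.
have xau := adjx _ _ uS xS xu; have xav := adjx _ _ vT xT xv.
have bS := frontier_big_clique _ _ _ cfG xS xau uS.
have bT := frontier_big_clique _ _ _ cfG xT xav vT.
have [y yx] := big_cliques_meet_twice _ _ _ bS bT (setU11 _ _) (setU11 _ _).
rewrite !inE (negbTE yx) /= => /andP[/andP[yS _] /andP[yT xy]].
case/andP: bT => /forall_inP/(_ v).
rewrite !inE vT xav orbT => /(_ isT)/subsetP/(_ y).
rewrite in_setU1 in_setD yT inE xy orbT => /(_ isT) yv _.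
by rewrite (subsetP vS _ yv) in yS.
Qed.

(** A minimal power dominating set of vertices in big cliques may still have
    overlapping closed neighbourhoods.  Moving each of its vertices [s], inside a
    big clique, to a place that the other vertices do not observe keeps the set
    power dominating and separates the neighbourhoods. *)
Theorem packing_pd_set : connected G -> claw_free G ->
  exists2 S, pd_set k S & packing S.
Proof.
move=> conG cfG.
have frontier S x y : x \in pd_infty k S -> adj x y -> y \notin pd_infty k S ->
    in_big_clique x.
  move=> xP xy yP; apply/existsP; exists (x |: (nbhd x :\: pd_infty k S)).
  by rewrite setU11 (frontier_big_clique _ _ _ cfG xP xy yP).
pose M := [set x | in_big_clique x].
have [M0|[m mM]] := set_0Vmem M.
  case: (conG) => /card_gt0P[v _] _; exists [set v].
    apply: (pd_set_of_no_frontier _ v) => // [|x y xP xy]; first exact: set11.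
    apply/negPn/negP=> yP; have := in_set0 x.
    by rewrite -M0 inE (frontier _ _ _ xP xy yP).
  by move=> u w /set1P-> /set1P->; rewrite eqxx.
have pdM : pd_set k M.
  apply: (pd_set_of_no_frontier _ m) => // x y xP xy; apply/negPn/negP=> yP.
  have xM : x \in M by rewrite inE (frontier _ _ _ xP xy yP).
  have /subsetP/(_ y) := cl_nbhd_sub_infty _ _ xM.
  by rewrite (negbTE yP) in_cl_nbhd xy orbT => /(_ isT).
have [S /minsetP[/andP[SM /eqP pdS] minS] _] :
    {S : {set G} | minset (fun S => (S \subset M) && pd_set k S) S & S \subset M}.
  by apply: minset_exists; rewrite subxx.
pose P s := pd_infty k (S :\ s).
(* [u] stands for s: it is a vertex of a big clique through [s] that is not
   observed from the rest of [S]. *)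
pose repl s u := (u \notin P s) &&
  [exists K : {set G}, [&& s \in K, u \in K & big_clique K]].
have replP s : exists u, (s \in S) ==> repl s u.
  case: (boolP (s \in S)) => [sS|_]; last by exists s.
  have := subsetP SM _ sS; rewrite inE => /existsP[K /andP[sK bK]].
  (* If all of K were observed without s, so would N[s], against minimality. *)
  case: (boolP (K \subset P s)) => [KP|/subsetPn[u uK uP]]; last first.
    by exists u; rewrite /= /repl uP; apply/existsP; exists K; rewrite sK uK.
  have NsP := big_clique_activates _ _ _ (@pd_infty_closed _) bK KP sK.
  have pds : pd_set k (S :\ s).
    rewrite /pd_set -subTset -pdS; apply: pd_infty_min => [|v vS].
      exact: pd_infty_closed.
    case: (v =P s) => [-> //|/eqP vs].
    by apply: cl_nbhd_sub_infty; rewrite in_setD1 vs.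
  have /setP/(_ s) := minS _ (introT andP (conj (subset_trans (subsetDl _ _) SM) pds))
    (subsetDl _ _).
  by rewrite sS !inE eqxx.
pose u s := xchoose (replP s).
have uP s : s \in S -> repl s (u s).
  by move=> sS; apply: (implyP (xchooseP (replP s))).
have act s T : s \in S -> cl_nbhd s \subset pd_infty k T ->
    cl_nbhd (u s) \subset pd_infty k T.
  move=> /uP/andP[_ /existsP[K /and3P[sK uK bK]]] sT.
  exact: (big_clique_activated _ _ _ _ (@pd_infty_closed _) bK sK).
exists [set u s | s in S].
  rewrite /pd_set -subTset -pdS; apply: pd_infty_min => [|s sS].
    exact: pd_infty_closed.
  have /andP[_ /existsP[K /and3P[sK uK bK]]] := uP s sS.
  apply: (big_clique_activated _ _ _ _ (@pd_infty_closed _) bK uK) => //.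
  by apply: cl_nbhd_sub_infty; apply: imset_f.
move=> _ _ /imsetP[s sS ->] /imsetP[t tS ->] nst.
have {}nst : s != t by apply: contraNneq nst => ->.
have [/andP[us _] /andP[ut _]] := (uP s sS, uP t tS).
have Nt : cl_nbhd (u t) \subset P s.
  by apply: act => //; apply: cl_nbhd_sub_infty; rewrite in_setD1 eq_sym nst.
have Ns : cl_nbhd (u s) \subset P t.
  by apply: act => //; apply: cl_nbhd_sub_infty; rewrite in_setD1 nst.
rewrite disjoint_subset; apply/subsetP=> x xs; rewrite inE; apply/negP=> xt.
exact: (frontiers_disjoint _ _ _ _ _ cfG us Nt ut Ns xs xt).
Qed.

End Propagation.

Lemma packing_card (G : sgraph) (r : nat) (S : {set G}) :
  regular G r -> packing G S -> (#|S| * r.+1 <= #|G|)%N.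
Proof.
move=> regG pS.
have -> : (#|S| * r.+1 = \sum_(s in S) #|cl_nbhd s|)%N.
  by rewrite -sum_nat_const; apply: eq_bigr => s _; rewrite card_cl_nbhd regG.
rewrite (eq_bigr (fun s => \sum_(x : G) (x \in cl_nbhd s))%N); last first.
  by move=> s _; rewrite -sum1_card big_mkcond.
rewrite exchange_big /= -sum1_card; apply: leq_sum => x _.
rewrite -big_mkcondr sum1_card; apply/card_le1_eqP => t s.
rewrite -!topredE /= => /andP[tS xt] /andP[sS xs]; apply/eqP/negPn/negP => nst.
by have /disjointFr/(_ xs) := pS _ _ sS tS nst; rewrite xt.
Qed.

(** * Complete graphs *)

Section Complete.
Variable n : nat.

Definition complete_adj : rel 'I_n := fun x y => x != y.

Lemma complete_adj_sym : symmetric complete_adj.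
Proof. by move=> x y; rewrite /complete_adj eq_sym. Qed.

Lemma complete_adj_irr : irreflexive complete_adj.
Proof. by move=> x; rewrite /complete_adj eqxx. Qed.

Definition complete : sgraph := SGraph complete_adj_sym complete_adj_irr.

Lemma complete_cl_nbhd (x : complete) : cl_nbhd x = setT.
Proof. by apply/setP=> y; rewrite in_cl_nbhd inE /= /complete_adj eq_sym orbN. Qed.

Lemma complete_connected : (0 < n)%N -> connected complete.
Proof.
move=> n0; split=> [|x y]; first by rewrite card_ord.
by case: (x =P y) => [->|/eqP xy]; [apply: connect0|apply: connect1].
Qed.

Lemma complete_regular : regular complete n.-1.
Proof.
move=> x; apply: succn_inj; rewrite -card_cl_nbhd complete_cl_nbhd cardsT card_ord.
by rewrite prednK //; case: x => x /= lt_x; apply: leq_ltn_trans lt_x.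
Qed.

Lemma complete_claw_free : claw_free complete.
Proof.
case=> S [f [g fK gK] fadj].
pose a : biclique 1 3 := inr ord0; pose b : biclique 1 3 := inr ord_max.
have := fadj (g a) (g b); rewrite !gK => /esym/negbT/negPn/eqP/val_inj.
by move/(can_inj gK).
Qed.

Lemma complete_pd_number k : (0 < n)%N -> pd_number complete k = 1%N.
Proof.
move=> n0; pose x : complete := Ordinal n0.
apply/eqP; rewrite eqn_leq; apply/andP; split.
  rewrite -(cards1 x); apply: pd_number_le.
  by rewrite /pd_set -subTset -(complete_cl_nbhd x) cl_nbhd_sub_infty ?set11.
rewrite /pd_number; case: arg_minnP => [|S pdS _]; first exact: pd_setT.
by apply: pd_set_nonempty pdS; rewrite card_ord.
Qed.

End Complete.

Import GRing.Theory Num.Theory.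
Local Open Scope ring_scope.

Theorem theorem1p1 (k l : nat) (hl : (1 <= l)%N) (hkl : (l <= k)%N) :
  (forall G : sgraph,
     connected G -> claw_free G -> regular G (k + l + 1) ->
     (pd_number G k)%:R <= #|G|%:R / (k + l + 2)%:R :> rat)
  /\
  (exists G : sgraph,
     [/\ connected G, claw_free G, regular G (k + l + 1)
       & (pd_number G k)%:R = #|G|%:R / (k + l + 2)%:R :> rat]).
Proof.
split=> [G conG cfG regG|].
  have degG (v : G) : (#|nbhd v| <= (2 * k).+1)%N by rewrite regG; lia.
  have [S pdS pS] := packing_pd_set _ _ degG conG cfG.
  rewrite ler_pdivlMr ?ltr0n ?addn2 // -natrM ler_nat.
  apply: leq_trans (packing_card _ _ _ regG pS).
  by rewrite addn1 leq_mul2r pd_number_le ?orbT.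
exists (complete (k + l + 2)); split.
- by apply: complete_connected; rewrite addn2.
- exact: complete_claw_free.
- have -> : (k + l + 1 = (k + l + 2).-1)%N by lia.
  exact: complete_regular.
- rewrite complete_pd_number ?addn2 // card_ord divff //.
  by rewrite pnatr_eq0.
Qed.
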